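(* Let $p$ be an odd prime, $q=p^3$, and let $G=\langle a,b\rangle\le\mathfrak{S}_q$ be the group described in the context. Let $f$ be a permutation group polynomial over $\mathbb{F}_q$ corresponding to $G$, with permutation polynomial tuple $\underline{\beta}_f=(\beta_0,\beta_1,\ldots,\beta_{q-1})\in\mathfrak{S}_q^q$. Then there are $q!$ permutation group polynomials equivalent to $f$.
   Context: $\mathfrak{S}_q$ is the symmetric group on $\mathbb{F}_q=\{c_0,\ldots,c_{q-1}\}$ (a fixed enumeration); permutations are composed right to left. The permutations are $$a=(c_{0},c_{1},\ldots,c_{p^2-1})(c_{p^2},\ldots,c_{2p^2-1})\cdots (c_{p^2(p-1)},\ldots,c_{p^3-1}),\qquad b=b_{0}\,b_{1}^{1+p}\,b_2^{1+2p}\cdots b_{p-1}^{1+(p-1)p},$$ where $b_{k}=(c_{k},c_{p^2+k},\ldots,c_{(p-1)p^2+k},\;c_{p+k},c_{p+p^2+k},\ldots,c_{p+(p-1)p^2+k},\;\ldots,\;c_{(p-1)p+k},c_{(p-1)p+p^2+k},\ldots,c_{(p-1)p+(p-1)p^2+k})$ is a $p^2$-cycle (entries $c_{jp+ip^2+k}$, with $i=0,\ldots,p-1$ running first for $j=0$, then $j=1$, etc.). The group $G=\langle a,b\rangle$ has order $q$ and no non-identity element of $G$ has a fixed point. Functions $\mathbb{F}_q^2\to\mathbb{F}_q$ are identified with polynomials in $\mathbb{F}_q[X_1,X_2]$ of degree less than $q$ in each variable (these are the polynomials being counted). A bivariate polynomial $f$ is a local permutation polynomial (LPP) if for every $c\in\mathbb{F}_q$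 both $x\mapsto f(x,c)$ and $x\mapsto f(c,x)$ are bijections of $\mathbb{F}_q$. Bivariate LPPs are in bijection with permutation polynomial tuples, i.e. tuples $\underline{\beta}_f=(\beta_0,\ldots,\beta_{q-1})\in\mathfrak{S}_q^q$ such that $\beta_i\beta_j^{-1}$ has no fixed point for $i\ne j$, via $f(x,\beta_i(x))=c_i$ for all $x\in\mathbb{F}_q$ and all $i$. An LPP is a permutation group polynomial if the entries of its tuple form a subgroup of $\mathfrak{S}_q$, and it then corresponds to that subgroup. Two LPPs $f,g$ with tuples $(\beta_0,\ldots,\beta_{q-1})$ and $(\gamma_0,\ldots,\gamma_{q-1})$ are equivalent if there exist $\lambda,\sigma\in\mathfrak{S}_q$ with $\lambda\beta_i\sigma=\gamma_i$ for all $0\le i\le q-1$. *)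

(* Defs.v *)
From mathcomp Require Import all_boot all_order all_fingroup all_algebra.
From mathcomp Require Export mpoly.

Set Implicit Arguments.
Unset Strict Implicit.
Unset Printing Implicit Defensive.

Import GRing.Theory.
Local Open Scope ring_scope.

(* In MathComp, (s * t)%g x = t (s x); [perm_comp s t] composes right to left,
   i.e. perm_comp s t x = s (t x). *)
Definition perm_comp (T : finType) (s t : {perm T}) : {perm T} := (t * s)%g.

(* The cycle (x_0, x_1, ..., x_{m-1}) on the entries of s = [:: x_0; ...; x_{m-1}].
   [undup s] is s itself for the repetition-free sequences used below; it only
   serves to make the definition total. *)
Definition cyc (T : finType) (s : seq T) : {perm T} :=
  perm (can_inj (prev_next (undup_uniq s))).

Section Generators.
Variables (F : finFieldType) (p : nat) (c : seq F).

Definition perm_a : {perm F} :=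
  \big[@perm_comp F/1%g]_(l < p) cyc (T := F) [seq c`_(l * p ^ 2 + m) | m <- iota 0 (p ^ 2)].

(* j is the outer (slow) index, i the inner (fast) one. *)
Definition cycle_b (k : nat) : {perm F} :=
  cyc (T := F) [seq c`_(j * p + i * p ^ 2 + k) | j <- iota 0 p, i <- iota 0 p].

Definition perm_b : {perm F} :=
  \big[@perm_comp F/1%g]_(k < p) (cycle_b k ^+ (1 + k * p))%g.

Definition group_ab : {group {perm F}} := <<[set perm_a; perm_b]>>%G.

End Generators.

Section LocalPermutationPolynomials.
Variables (F : finFieldType) (q : nat).

Definition eval2 (f : {mpoly F[2]}) (x y : F) : F := f.@[tnth [tuple x; y]].

(* Degree less than #|F| in each variable: the canonical representative of a
   function F^2 -> F. *)
Definition reduced (f : {mpoly F[2]}) : Prop :=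
  forall m, m \in msupp f -> forall i : 'I_2, (m i < #|F|)%N.

Definition lpp (f : {mpoly F[2]}) : Prop :=
  forall z : F, bijective (fun x => eval2 f x z) /\
                bijective (fun x => eval2 f z x).

Definition perm_poly_tuple (beta : q.-tuple {perm F}) : Prop :=
  forall i j : 'I_q, i != j ->
  forall x : F, perm_comp (tnth beta i) (tnth beta j)^-1%g x <> x.

(* [beta] is the permutation polynomial tuple of [f] with respect to the
   enumeration [c] of F. *)
Definition tuple_of_lpp (c : q.-tuple F) (f : {mpoly F[2]})
    (beta : q.-tuple {perm F}) : Prop :=
  perm_poly_tuple beta /\
  forall (i : 'I_q) (x : F), eval2 f x (tnth beta i x) = tnth c i.

Definition perm_group_poly (c : q.-tuple F) (f : {mpoly F[2]}) : Prop :=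
  lpp f /\
  exists2 beta : q.-tuple {perm F},
    tuple_of_lpp c f beta & group_set [set s in beta].

Definition lpp_equiv (c : q.-tuple F) (f g : {mpoly F[2]}) : Prop :=
  exists beta gamma : q.-tuple {perm F},
    [/\ tuple_of_lpp c f beta, tuple_of_lpp c g gamma &
        exists lambda sigma : {perm F}, forall i : 'I_q,
          perm_comp lambda (perm_comp (tnth beta i) sigma) = tnth gamma i].

End LocalPermutationPolynomials.

Definition has_exactly (T : eqType) (P : T -> Prop) (n : nat) : Prop :=
  exists s : seq T, [/\ uniq s, size s = n & forall x, x \in s <-> P x].

(* Main.v *)
Require Import Defs.
From mathcomp Require Import all_boot all_order all_fingroup all_algebra.

(** Only the regularity of [G] matters. A tuple [lambda beta_i sigma] whose
    entries form a group contains the identity, hence is a conjugate of a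
    relabelling [i |-> u^-1 beta_i] of [G] with [u \in G]. Fix a point [x0].
    Since the centralizer of a regular group is transitive, the conjugating
    permutation [pi] can be normalised so that [u x0 = pi^-1 x0]; the tuple then
    maps [x0] to [pi (beta_i x0)], so that [pi] is determined by the tuple. This
    gives a bijection between the symmetric group and these tuples. *)

Set Implicit Arguments.
Unset Strict Implicit.
Unset Printing Implicit Defensive.

(** * Reduced polynomials and functions of two variables *)

Section ReducedPolynomials.
Local Open Scope ring_scope.
Import GRing.Theory.
Variable F : finFieldType.
Implicit Types f g : {mpoly F[2]}.

Definition mnm2 (e : 'I_#|F| * 'I_#|F|) : 'X_{1..2} :=
  [multinom (tnth [tuple nat_of_ord e.1; nat_of_ord e.2] k) | k < 2].

Lemma mnm2_inj : injective mnm2.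
Proof.
move=> [i j] [i' j'] /mnmP eq_m.
have := eq_m ord0; rewrite !mnmE /= => /ord_inj ->.
by have := eq_m ord_max; rewrite !mnmE /= => /ord_inj ->.
Qed.

Definition mpoly2 (t : {ffun 'I_#|F| * 'I_#|F| -> F}) : {mpoly F[2]} :=
  \sum_e t e *: 'X_[mnm2 e].

Lemma mcoeff_mpoly2 t m : (mpoly2 t)@_m = \sum_(e | mnm2 e == m) t e.
Proof.
rewrite /mpoly2 raddf_sum /= [RHS]big_mkcond /=; apply: eq_bigr => e _.
by rewrite mcoeffZ mcoeffX; case: eqP => _; rewrite ?mulr1 ?mulr0.
Qed.

Lemma reduced_mpoly2 t : reduced (mpoly2 t).
Proof.
move=> m; rewrite mcoeff_msupp mcoeff_mpoly2 => nz_m i.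
have [e /eqP <-|no_e] := pickP (fun e => mnm2 e == m); last first.
  by rewrite big_pred0 ?eqxx in nz_m.
by rewrite mnmE (tnth_nth 0%N); case: i => [[|[|?]] ?] /=.
Qed.

Lemma reduced_mpoly2P f : reduced f -> f = mpoly2 [ffun e => f@_(mnm2 e)].
Proof.
move=> red_f; apply/mpolyP => m; rewrite mcoeff_mpoly2.
have [e /eqP <-|no_e] := pickP (fun e => mnm2 e == m).
  rewrite (big_pred1 e) ?ffunE // => e'; exact: (inj_eq mnm2_inj).
rewrite big_pred0 //; apply: memN_msupp_eq0; apply/negP => /red_f lt_m.
have /eqP[] := no_e (Ordinal (lt_m ord0), Ordinal (lt_m ord_max)).
apply/mnmP => i; rewrite mnmE (tnth_nth 0%N).
by case: i => [[|[|//]] lti] /=; apply: (congr1 m); apply: val_inj.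
Qed.

Lemma eval2_mpoly2 t x y :
  eval2 (mpoly2 t) x y = \sum_j (\sum_i t (i, j) * x ^+ i) * y ^+ j.
Proof.
under eq_bigr do rewrite mulr_suml.
rewrite exchange_big pair_bigA /eval2 /mpoly2 raddf_sum /=; apply: eq_bigr => -[i j] _ /=.
by rewrite mevalZ mevalX !big_ord_recl big_ord0 !mnmE /= !(tnth_nth 0) /= mulr1 mulrA.
Qed.

(** A univariate polynomial of size at most [#|F|] that vanishes on all of [F] has too many roots to
    be nonzero. *)
Lemma eq_coef_roots (a : 'I_#|F| -> F) :
  (forall y, \sum_j a j * y ^+ j = 0) -> forall j, a j = 0.
Proof.
move=> a0 j; have p0: rVpoly (\row_j a j) = 0.
  apply: (@roots_geq_poly_eq0 _ _ (enum F)); rewrite ?enum_uniq //.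
    apply/allP => y _; apply/rootP; rewrite horner_poly -[RHS](a0 y).
    by apply: eq_bigr => i _; rewrite valK mxE.
  by rewrite -cardE size_poly.
by have := coef_rVpoly_ord (\row_j a j) j; rewrite p0 coef0 mxE.
Qed.

Lemma eval2_mpoly2_inj t t' :
  (forall x y, eval2 (mpoly2 t) x y = eval2 (mpoly2 t') x y) -> t = t'.
Proof.
move=> eq_ev; apply/ffunP => -[i j]; apply/eqP; rewrite -subr_eq0; apply/eqP.
(* The one-variable case is used twice: once for the powers of [x], then, with [x] fixed, for the
   powers of [y]. *)
apply: (eq_coef_roots (a := fun i => t (i, j) - t' (i, j))) => x.
apply: (eq_coef_roots
  (a := fun j => \sum_i (t (i, j) - t' (i, j)) * x ^+ i)) => y.
have /eqP := eq_ev x y; rewrite -subr_eq0 !eval2_mpoly2 -sumrB => /eqP ev0.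
rewrite -[RHS]ev0; apply: eq_bigr => k _; rewrite -mulrBl -sumrB; congr (_ * _).
by apply: eq_bigr => l _; rewrite mulrBl.
Qed.

Lemma reduced_eq f g :
  reduced f -> reduced g -> (forall x y, eval2 f x y = eval2 g x y) -> f = g.
Proof.
move=> /reduced_mpoly2P -> /reduced_mpoly2P -> eq_fg.
by congr mpoly2; apply: eval2_mpoly2_inj.
Qed.

(** No interpolation formula is needed: evaluation is injective between two finite sets of equal
    size, the coefficient arrays and the functions on [F * F], hence onto. *)
Lemma reduced_interpolation (h : F -> F -> F) :
  exists2 g, reduced g & forall x y, eval2 g x y = h x y.
Proof.
pose ev (t : {ffun 'I_#|F| * 'I_#|F| -> F}) :=
  [ffun z : F * F => eval2 (mpoly2 t) z.1 z.2].
have ev_inj: injective ev.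
  move=> t t' /ffunP eq_ev; apply: eval2_mpoly2_inj => x y.
  by have := eq_ev (x, y); rewrite !ffunE.
have [|ev' _ evK] := inj_card_bij ev_inj; first by rewrite !card_ffun !card_prod card_ord.
exists (mpoly2 (ev' [ffun z => h z.1 z.2])); first exact: reduced_mpoly2.
by move=> x y; have /ffunP/(_ (x, y)) := evK [ffun z => h z.1 z.2]; rewrite !ffunE.
Qed.

End ReducedPolynomials.

(** * Regular permutation groups and their group-valued translates *)

Section RegularGroups.
Local Open Scope group_scope.
Variables (T : finType) (G : {group {perm T}}).
Hypothesis transG : forall x y : T, exists2 g, g \in G & g x = y.
Hypothesis freeG : forall g x, g \in G -> g x = x -> g = 1.

Lemma free_inj (g h : {perm T}) z : g \in G -> h \in G -> g z = h z -> g = h.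
Proof.
move=> Gg Gh eq_gh; apply/eqP; rewrite eq_mulgV1; apply/eqP.
by apply: (freeG (x := z)); rewrite ?groupM ?groupV // permM eq_gh permK.
Qed.

(* Identifying [T] with [G] through [g |-> g x], the required permutation is a
   translation on the other side. *)
Lemma centralizer_transitive (x y : T) : exists2 t, t \in 'C(G) & t x = y.
Proof.
have [e Ge ex] := fin_all_exists2 (transG x).
have e_inj: injective (fun z => e z y).
  by move=> z z' /(free_inj (Ge z) (Ge z')) eq_e; rewrite -(ex z) eq_e.
exists (perm e_inj); last first.
  by rewrite permE (freeG (Ge x) (ex x)) ?perm1.
apply/centP => h Gh; apply/permP => z; rewrite !permM !permE -permM.
(* Both [e z * h] and [e (h z)] lie in [G] and send [x] to [h z]. *)
congr (fun_of_perm _ y); apply: (free_inj (z := x)); rewrite ?groupM //.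
by rewrite permM !ex.
Qed.

Variables (q : nat) (beta : q.-tuple {perm T}).
Hypothesis betaG : [set s in beta] = G.

Let Gbeta i : tnth beta i \in G.
Proof. by rewrite -betaG inE mem_tnth. Qed.

Let betaP g : g \in G -> exists i, g = tnth beta i.
Proof. by rewrite -betaG inE => /tnthP. Qed.

(** Products apply their left factor first, so [sigma * tnth beta i * lambda] is the composite of
    [sigma], then [beta_i], then [lambda]. *)
Lemma card_group_translates (x0 : T) :
  #|[set gamma : q.-tuple {perm T} | group_set [set s in gamma] &
      [exists lambda : {perm T}, exists sigma : {perm T}, forall i,
         tnth gamma i == sigma * tnth beta i * lambda]]| = #|T|`!.
Proof.
have [u Gu u_x0] := fin_all_exists2 (fun pi : {perm T} => transG x0 (pi^-1 x0)).
pose tr pi := [tuple ((u pi)^-1 * tnth beta i) ^ pi | i < q].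
have tr_x0 pi i : tnth (tr pi) i x0 = pi (tnth beta i x0).
  by rewrite tnth_mktuple conjgE !permM -u_x0 permK.
have tr_inj: injective tr.
  move=> pi pi' eq_tr; apply/permP => y; have [g Gg <-] := transG x0 y.
  by have [i ->] := betaP Gg; rewrite -!tr_x0 eq_tr.

have card_permT: #|{perm T}| = #|T|`!.
  rewrite -[in RHS]cardsT -card_perm; apply: eq_card => s.
  by rewrite !inE; apply/esym/subsetP => z; rewrite inE.
rewrite -card_permT -cardsT -(card_imset _ tr_inj).
apply: eq_card => gamma; rewrite inE; apply/andP/imsetP => [[gr_gamma] | [pi _ ->]].
  move=> /existsP[lambda] /existsP[sigma] /forallP eq_gamma.
  have: 1 \in [set s in gamma] by case/group_setP: gr_gamma.
  rewrite inE => /tnthP[i0 eq_1]; set g := tnth beta i0.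
  (* The entry at [i0] being the identity eliminates [sigma]: every entry of [gamma] is the
     conjugate by [lambda] of [g^-1 * beta_i]. *)
  have def_sigma: sigma = lambda^-1 * g^-1.
    rewrite -invMg -[RHS]mul1g eq_1 (eqP (eq_gamma i0)) -/g.
    by rewrite -[sigma * g * lambda]mulgA mulgK.
  (* Replacing [lambda] by [t * lambda] leaves the conjugates of elements of [G] unchanged, and this
     [t] makes the inverse of [t * lambda] send [x0] to [g x0]. *)
  have [t Ct tE] := centralizer_transitive (g x0) (lambda^-1 x0).
  have def_u: u (t * lambda) = g.
    by apply: (free_inj (Gu _) (Gbeta i0) (z := x0)); rewrite u_x0 invMg permM -tE permK.
  exists (t * lambda) => //; apply: eq_from_tnth => i.
  have Gi: g^-1 * tnth beta i \in G by rewrite groupM ?groupV ?Gbeta.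
  rewrite tnth_mktuple def_u (eqP (eq_gamma i)) def_sigma conjgM.
  rewrite [_ ^ t]conjgE -(centP Ct _ Gi) mulKg.
  by rewrite conjgE !mulgA.
split.
  (* Left multiplication by the inverse of [u pi] only permutes [G], so the entries form a conjugate
     of [G]. *)
  rewrite (_ : [set s in _] = (G :^ pi)%G) ?groupP //; apply/setP => s.
  rewrite inE mem_conjg; apply/tnthP/idP => [[i ->] | Gs].
    by rewrite tnth_mktuple -conjgM mulgV conjg1 groupM ?groupV.
  have [|i eq_i] := betaP (g := u pi * s ^ pi^-1); first by rewrite groupM.
  by exists i; rewrite tnth_mktuple -eq_i mulKg conjgKV.
apply/existsP; exists pi; apply/existsP; exists ((u pi * pi)^-1).
by apply/forallP => i; rewrite tnth_mktuple conjgE invMg !mulgA.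
Qed.
End RegularGroups.

(** * Transfer of the count from tuples to polynomials *)

Section TuplesAndPolynomials.
Variables (F : finFieldType) (q : nat) (c : q.-tuple F).
Hypotheses (cardF : #|F| = q) (uniq_c : uniq c).
Implicit Types (f g : {mpoly F[2]}) (beta gamma : q.-tuple {perm F}).

(** A fixed point [x] of [beta_i beta_j^-1] is an agreement of [beta_i] and [beta_j] at
    [beta_j^-1 x]. *)
Lemma perm_poly_tupleP beta :
  perm_poly_tuple beta <-> forall x, injective (fun i => tnth beta i x).
Proof.
split=> [ppt x i j eq_ij | inj_beta i j /eqP ne_ij x].
  apply/eqP/idPn => ne_ij; apply: (ppt i j ne_ij (tnth beta j x)).
  by rewrite /perm_comp permM permK.
rewrite /perm_comp permM => fix_x; apply: ne_ij.
by apply: (inj_beta ((tnth beta j)^-1 x)%g); rewrite /= fix_x permKV.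
Qed.

Lemma perm_poly_tuple_onto beta x y :
  perm_poly_tuple beta -> exists i, tnth beta i x = y.
Proof.
move=> /perm_poly_tupleP/(_ x)/inj_card_bij[|h _ hK]; first by rewrite cardF card_ord.
by exists (h y); apply: hK.
Qed.

(** The graphs of the entries cover the plane and are the level sets of [g]; each meets every
    horizontal and vertical line once. *)
Lemma tuple_of_lpp_lpp g gamma : tuple_of_lpp c g gamma -> lpp g.
Proof.
case=> ppt ev z; have /tuple_uniqP c_inj := uniq_c.
split; apply: injF_bij => x x' /=.
  have [i <-] := perm_poly_tuple_onto x z ppt.
  have [i' eq_z] := perm_poly_tuple_onto x' (tnth gamma i x) ppt.
  rewrite ev -eq_z ev => /c_inj eq_i.
  by move: eq_z; rewrite eq_i => /perm_inj.
have [i <-] := perm_poly_tuple_onto z x ppt.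
have [i' <-] := perm_poly_tuple_onto z x' ppt.
by rewrite !ev => /c_inj ->.
Qed.

Lemma tuple_of_lpp_inj g beta gamma :
  tuple_of_lpp c g beta -> tuple_of_lpp c g gamma -> beta = gamma.
Proof.
move=> g_beta [_ ev_gamma]; have lpp_g := tuple_of_lpp_lpp g_beta.
apply: eq_from_tnth => i; apply/permP => x.
by apply: (bij_inj (lpp_g x).2); rewrite ev_gamma; case: g_beta => _ ->.
Qed.

Lemma tuple_of_lpp_reduced_eq f g gamma :
  reduced f -> reduced g -> tuple_of_lpp c f gamma -> tuple_of_lpp c g gamma ->
  f = g.
Proof.
move=> red_f red_g [ppt ev_f] [_ ev_g]; apply: reduced_eq => // x y.
by have [i <-] := perm_poly_tuple_onto x y ppt; rewrite ev_f ev_g.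
Qed.

(** The condition on [gamma] sits under the existential so that a polynomial can be chosen for all
    tuples at once. *)
Lemma exists_tuple_of_lpp gamma :
  exists2 g, reduced g & perm_poly_tuple gamma -> tuple_of_lpp c g gamma.
Proof.
(* The default [0] is taken only at points lying on none of the graphs. *)
pose h x y := oapp (tnth c) 0%R [pick i | tnth gamma i x == y].
have [g red_g ev] := reduced_interpolation h; exists g => // ppt; split=> // i x.
rewrite ev /h; case: pickP => [j /eqP|/(_ i)]; last by rewrite eqxx.
by have /perm_poly_tupleP inj_gamma := ppt => /inj_gamma ->.
Qed.

Lemma count_equivalent_perm_group_poly f beta (G : {group {perm F}}) :
  tuple_of_lpp c f beta -> [set s in beta] = G ->
  has_exactly (fun g => [/\ reduced g, perm_group_poly c g & lpp_equiv c f g])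
    #|F|`!.
Proof.
move=> f_beta betaG; have ppt := f_beta.1.
have Gbeta i : tnth beta i \in G by rewrite -betaG inE mem_tnth.
have transG x y : exists2 s : {perm F}, s \in G & s x = y.
  by have [i <-] := perm_poly_tuple_onto x y ppt; exists (tnth beta i).
have freeG (s : {perm F}) x : s \in G -> s x = x -> s = 1%g.
  (* The identity is itself an entry, and an entry with a fixed point agrees with it there, so the
     two indices coincide. *)
  rewrite -betaG inE => /tnthP[i ->] fix_x.
  have: 1%g \in G by rewrite group1.
  rewrite -betaG inE => /tnthP[j eq_1].
  rewrite eq_1; congr (tnth beta _); have /perm_poly_tupleP inj_beta := ppt.
  by apply: (inj_beta x); rewrite /= -eq_1 perm1.
have cardA := card_group_translates transG freeG betaG (0%R : F).
set A := [set _ | _ & _] in cardA.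
have [P redP PE] := fin_all_exists2 exists_tuple_of_lpp.
have {}PE gamma : gamma \in A -> tuple_of_lpp c (P gamma) gamma.
  rewrite inE => /andP[_ /existsP[lambda /existsP[sigma /forallP eq_gamma]]].
  apply: PE; apply/perm_poly_tupleP => x i j /=.
  rewrite (eqP (eq_gamma i)) (eqP (eq_gamma j)) !permM => /perm_inj.
  by have /perm_poly_tupleP := ppt; apply.
exists [seq P gamma | gamma <- enum A]; split.
- rewrite map_inj_in_uniq ?enum_uniq // => gamma gamma'.
  rewrite !mem_enum => /PE P_gamma /PE P_gamma' eqP_.
  by apply: (tuple_of_lpp_inj P_gamma); rewrite eqP_.
- by rewrite size_map -cardE.
move=> g; split=> [/mapP[gamma] | [red_g [_ [gamma g_gamma gr_gamma]]]].
  rewrite mem_enum => A_gamma ->; have P_gamma := PE _ A_gamma.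
  move: A_gamma; rewrite inE => /andP[gr_gamma].
  move=> /existsP[lambda /existsP[sigma /forallP eq_gamma]].
  split; first exact: redP.
    by split; [apply: tuple_of_lpp_lpp P_gamma | exists gamma].
  exists beta, gamma; split=> //; exists lambda, sigma => i.
  by rewrite (eqP (eq_gamma i)).
case=> beta' [gamma' [f_beta' g_gamma' [lambda [sigma eq_gamma]]]].
(* The tuples supplied by the equivalence are the ones already at hand, since a polynomial
   determines its tuple. *)
have ? := tuple_of_lpp_inj f_beta' f_beta; subst beta'.
have ? := tuple_of_lpp_inj g_gamma' g_gamma; subst gamma'.
have A_gamma : gamma \in A.
  rewrite inE gr_gamma; apply/existsP; exists lambda; apply/existsP.
  by exists sigma; apply/forallP => i; rewrite -eq_gamma.
apply/mapP; exists gamma; rewrite ?mem_enum //.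
exact: (tuple_of_lpp_reduced_eq red_g (redP _) g_gamma (PE _ A_gamma)).
Qed.

End TuplesAndPolynomials.

Theorem proposition4p7 (p : nat) (F : finFieldType) (c : (p ^ 3).-tuple F)
    (f : {mpoly F[2]}) (beta : (p ^ 3).-tuple {perm F}) :
  prime p -> odd p -> #|F| = (p ^ 3)%N ->
  uniq c ->
  reduced f -> perm_group_poly c f ->
  tuple_of_lpp c f beta ->
  [set s in beta] = group_ab p c :> {set {perm F}} ->
  has_exactly
    (fun g : {mpoly F[2]} =>
       [/\ reduced g, perm_group_poly c g & lpp_equiv c f g])
    ((p ^ 3)`!)%N.
Proof.
move=> _ _ cardF uniq_c _ _ f_beta betaG; rewrite -[X in X`!]cardF.
exact: count_equivalent_perm_group_poly f_beta betaG.
Qed.
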